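(* Let $G=(V,E)$ be a graph containing at least one cycle and having no isolated vertices. Then $P_{\mathrm{Edge\text{-}SD}}(G)=Q_{\mathrm{orient}}(G)$.
   Context: Graphs are finite, undirected, simple and loopless. For $F\subseteq E$, $V(F)$ is the set of vertices incident to at least one edge of $F$, and $d_F(u)$ is the degree of $u$ in $(V(F),F)$. The edge strong density polyhedron is $$P_{\mathrm{Edge\text{-}SD}}(G)=\Big\{x\in[0,1]^V:\ \sum_{u\in V(F)}(d_F(u)-1)x_u\ \ge\ |F|-|V(F)|+1\quad\text{for all } \emptyset\neq F\subseteq E\Big\}.$$ For $G$ without isolated vertices, $Q'_{\mathrm{orient}}(G)$ is the set of points $(x,y)$, with variables $x_v$ ($v\in V$) and $y^f_{e,v}$ ($f\in E$, $e\in E$, $v$ an endpoint of $e$), satisfying - $x_v+x_w+y^f_{e,v}+y^f_{e,w}\ge 1$ for all $e=vw\in E$ and $f\in E$; - $x_v+\sum_{e=vw\in E}y^f_{e,w}\ge 1$ for all $v\in V$ and $f\in E$ (the sum is over edges $e$ incident to $v$, with $w$ the other endpoint of $e$); - $\sum_{v\in V\setminus\{a,b\}}x_v+\sum_{e=vw\in E\setminus\{f\}}(y^f_{e,w}+y^f_{e,v})\le |V|-2$ for all $f=ab\in E$; - $y^f_{e,v}\ge 0$ for all $v\in V$, $e\in E$ incident to $v$, $f\in E$; - $0\le x_u\le 1$ for all $u\in V$. $Q_{\mathrm{orient}}(G)$ is the projection of $Q'_{\mathrm{orient}}(G)$ onto the $x$ variables. *)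

(* Defs.v *)
From mathcomp Require Import all_boot all_order all_algebra.

Set Implicit Arguments.
Unset Strict Implicit.
Unset Printing Implicit Defensive.

Import Order.TTheory GRing.Theory Num.Theory.
Local Open Scope ring_scope.

(* A finite simple loopless graph on V is given by its set of edges, each edge
   being a two-element set of vertices. *)
Definition simple_graph (V : finType) (E : {set {set V}}) : Prop :=
  forall e, e \in E -> #|e| = 2%N.

Definition adjacent (V : finType) (E : {set {set V}}) : rel V :=
  fun v w => [set v; w] \in E.

Definition has_cycle (V : finType) (E : {set {set V}}) : Prop :=
  exists2 c : seq V, (3 <= size c)%N & ucycle (adjacent E) c.

Definition no_isolated (V : finType) (E : {set {set V}}) : Prop :=
  forall v : V, exists w : V, adjacent E v w.

Definition incident_vertices (V : finType) (F : {set {set V}}) : {set V} :=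
  [set v | [exists e in F, v \in e]].

Definition degree (V : finType) (F : {set {set V}}) (u : V) : nat :=
  #|[set e in F | u \in e]|.

From mathcomp Require Import boolp classical_sets reals.

Definition P_Edge_SD (R : realType) (V : finType) (E : {set {set V}}) :
    set (V -> R) :=
  [set x : V -> R |
    (forall u, 0 <= x u <= 1) /\
    (forall F : {set {set V}}, F != finset.set0 -> F \subset E ->
      \sum_(u in incident_vertices F) ((degree F u)%:R - 1) * x u
        >= #|F|%:R - #|incident_vertices F|%:R + 1)]%classic.

Arguments P_Edge_SD R {V} E.

(* In a point (x, y), the coordinate y^f_{e,v} is [y f e v]. The values of y at
   triples where f or e is not an edge, or v is not an endpoint of e, occur in
   no constraint, so they do not affect the projection onto x. *)
Definition Q'_orient (R : realType) (V : finType) (E : {set {set V}}) :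
    set ((V -> R) * ({set V} -> {set V} -> V -> R)) :=
  [set xy : (V -> R) * ({set V} -> {set V} -> V -> R) |
    let x := xy.1 in let y := xy.2 in
    [/\ forall (f e : {set V}) (v w : V),
          f \in E -> e \in E -> e = [set v; w]%SET ->
          x v + x w + y f e v + y f e w >= 1,
        forall (f : {set V}) (v : V), f \in E ->
          x v + \sum_(w | adjacent E v w) y f [set v; w]%SET w >= 1,
        forall f : {set V}, f \in E ->
          \sum_(v | v \notin f) x v
            + \sum_(e in E | e != f) \sum_(v in e) y f e v <= #|V|%:R - 2,
        forall (f e : {set V}) (v : V),
          f \in E -> e \in E -> v \in e -> 0 <= y f e v
      & forall u, 0 <= x u <= 1]]%classic.

Arguments Q'_orient R {V} E.

Definition Q_orient (R : realType) (V : finType) (E : {set {set V}}) :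
    set (V -> R) :=
  (fst @` Q'_orient R E)%classic.

Arguments Q_orient R {V} E.

(* Main.v *)
(* Put d = 1 - x >= 0 and c_e = d_v + d_w - 1 for an edge e = vw. The edge strong
   density inequality for F reads c(F) + 1 <= d(V(F)). For a fixed f = ab, the
   coordinates y^f_f occur with no cost, and the remaining constraints say that
   the edges other than f can be fractionally oriented so that e contributes at
   least c_e in total, every vertex outside f receives exactly d_v, and a and b
   receive nothing. By the fractional Hall theorem this is possible iff
   c(F') <= d(V(F') \ f) for all sets F' of edges avoiding f, and adding
   c_f + 1 = d_a + d_b turns this into the density inequality for F' + f. *)
Require Import Defs.
From mathcomp Require Import all_boot all_order all_algebra.
From mathcomp Require Import boolp classical_sets reals.
From mathcomp Require Import lra.

Set Implicit Arguments.
Unset Strict Implicit.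
Unset Printing Implicit Defensive.

Import Order.TTheory GRing.Theory Num.Theory.
Local Open Scope ring_scope.

(** * A fractional Hall theorem for supplies and capacities *)

Section FractionalHall.
Variables (R : realFieldType) (I V : finType).
Implicit Types (r : {set I * V}) (S T : {set I}) (c : I -> R) (b : V -> R).

Definition nbhd r S : {set V} := [set v | [exists i in S, (i, v) \in r]]%SET.

(** Each [i] must send out at least [c i], each [v] can absorb at most [b v], and flow is allowed
    only on the pairs in [r]. *)
Definition hall_condition r c b :=
  forall S, \sum_(i in S) c i <= \sum_(v in nbhd r S) b v.

Lemma nbhdP r S v :
  reflect (exists2 i, i \in S & (i, v) \in r) (v \in nbhd r S).
Proof. by rewrite inE; apply: exists_inP. Qed.

Lemma ler_sum_subset (J : finType) (A B : {set J}) (g : J -> R) :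
  (forall j, 0 <= g j) -> A \subset B -> \sum_(j in A) g j <= \sum_(j in B) g j.
Proof.
move=> g0 /fintype.subsetP AB; rewrite [leLHS]big_mkcond [leRHS]big_mkcond /=.
apply: ler_sum => j _; case: ifPn => [/AB -> //|_]; by case: ifP.
Qed.

Lemma sum_subD1 (J : finType) (A : {set J}) (g : J -> R) a (e : R) :
  \sum_(j in A) (g j - (if j == a then e else 0)) =
  \sum_(j in A) g j - (if a \in A then e else 0).
Proof.
rewrite sumrB; congr (_ - _).
by rewrite -big_mkcondr /= big_mkcondl /= big_pred1_eq.
Qed.

(** A set containing [i] loses [e] on both sides. A set that avoids [i] but sees [v] loses [e] only
    on the right, so its slack must be at least [e]. *)
Lemma hall_push r c b i v e :
  hall_condition r c b -> (i, v) \in r ->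
  (forall S, i \notin S -> v \in nbhd r S ->
     e <= \sum_(v in nbhd r S) b v - \sum_(i in S) c i) ->
  hall_condition r (fun j => c j - (if j == i then e else 0))
    (fun w => b w - (if w == v then e else 0)).
Proof.
move=> H riv He S; rewrite !sum_subD1; have := H S.
case: (boolP (i \in S)) => iS.
  have -> : v \in nbhd r S by apply/nbhdP; exists i.
  by move=> ?; lra.
by case: (boolP (v \in nbhd r S)) => [/(He _ iS)|]; lra.
Qed.

Lemma nbhdD1 r S i v w : w \in nbhd r S -> ~~ ((i \in S) && (w == v)) ->
  w \in nbhd (r :\ (i, v))%SET S.
Proof.
case/nbhdP => j jS rjw nE; apply/nbhdP; exists j => //.
rewrite !inE rjw andbT xpair_eqE.
by apply: contra nE => /andP[/eqP <- ->]; rewrite jS.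
Qed.

Lemma nbhdS r r' S S' : r \subset r' -> S \subset S' ->
  nbhd r S \subset nbhd r' S'.
Proof.
move=> /fintype.subsetP rr /fintype.subsetP SS; apply/fintype.subsetP => w.
by case/nbhdP => j /SS jS /rr rjw; apply/nbhdP; exists j.
Qed.

Lemma sum_setUI (J : finType) (A B : {set J}) (g : J -> R) :
  \sum_(j in A) g j + \sum_(j in B) g j =
  \sum_(j in (A :|: B)%SET) g j + \sum_(j in (A :&: B)%SET) g j.
Proof.
rewrite ![\sum_(j in _) _]big_mkcond -!big_split /=.
apply: eq_bigr => j _; rewrite !inE.
by case: (j \in A); case: (j \in B); rewrite /= ?addr0 ?add0r.
Qed.

(* Uncrossing a tight set [S] with a set [T] that loses [v]: [v] lies in both
   neighbourhoods but not in the neighbourhood of the intersection, so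
   submodularity has slack [b v]. *)
Lemma hall_delete_tight r c b i v S :
  (forall w, 0 <= b w) -> hall_condition r c b ->
  i \notin S -> v \in nbhd r S ->
  \sum_(i in S) c i = \sum_(v in nbhd r S) b v ->
  hall_condition (r :\ (i, v))%SET c b.
Proof.
move=> b0 H iS vS tS T; set r' := (r :\ (i, v))%SET.
have HU := H (T :|: S)%SET; have HI := H (T :&: S)%SET.
have cUI := sum_setUI T S c.
have bUI := sum_setUI (nbhd r' T) (nbhd r S) b.
have UU : nbhd r (T :|: S)%SET \subset (nbhd r' T :|: nbhd r S)%SET.
  apply/fintype.subsetP => w wN; rewrite inE.
  have [->|wv] := eqVneq w v; first by rewrite vS orbT.
  case/nbhdP: wN => j; rewrite inE => /orP[jT|jS] rjw; last first.
    by apply/orP; right; apply/nbhdP; exists j.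
  apply/orP; left; apply: nbhdD1; first by apply/nbhdP; exists j.
  by rewrite (negbTE wv) andbF.
have II : nbhd r (T :&: S)%SET \subset (nbhd r' T :&: nbhd r S)%SET.
  apply/fintype.subsetP => w wN; rewrite inE; apply/andP; split; last first.
    by apply: fintype.subsetP wN; apply: nbhdS; rewrite ?subsetIr.
  have : w \in nbhd r' (T :&: S)%SET.
    by apply: nbhdD1 wN _; rewrite inE (negbTE iS) andbF.
  by apply: fintype.subsetP; apply: nbhdS; rewrite ?subsetIl.
have := ler_sum_subset b0 UU; have := ler_sum_subset b0 II.
by lra.
Qed.

(** Dropping [i] from a set keeps its supply, and the neighbourhood of what remains does not use the
    deleted pair. *)
Lemma hall_delete_supply r c b i v :
  (forall w, 0 <= b w) -> hall_condition r c b -> c i = 0 ->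
  hall_condition (r :\ (i, v))%SET c b.
Proof.
move=> b0 H ci T; have -> : \sum_(j in T) c j = \sum_(j in (T :\ i)%SET) c j.
  case: (boolP (i \in T)) => iT; first by rewrite (big_setD1 i iT) /= ci add0r.
  apply: eq_bigl => j; rewrite !inE; case: eqP => // ->.
  by rewrite (negbTE iT).
apply: le_trans (H _) _; apply: ler_sum_subset => //; apply/fintype.subsetP => w wN.
have : w \in nbhd (r :\ (i, v))%SET (T :\ i)%SET.
  by apply: nbhdD1 => //; rewrite !inE eqxx.
by apply: fintype.subsetP; apply: nbhdS; rewrite ?subD1set.
Qed.

(** Only [v] can leave a neighbourhood, and it carries no capacity. *)
Lemma hall_delete_capacity r c b i v :
  hall_condition r c b -> b v = 0 -> hall_condition (r :\ (i, v))%SET c b.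
Proof.
move=> H bv T; apply: le_trans (H _) _.
rewrite [leLHS]big_mkcond [leRHS]big_mkcond /= ler_sum // => w _.
have sub : nbhd (r :\ (i, v))%SET T \subset nbhd r T.
  by apply: nbhdS; rewrite ?subD1set.
have [->|wv] := eqVneq w v; first by rewrite bv !if_same.
case: ifPn => [wN|wN]; first by rewrite nbhdD1 // (negbTE wv) andbF.
by case: ifP => // /(fintype.subsetP sub); rewrite (negbTE wN).
Qed.

(* Push as much as possible through one pair [(i, v)]; when the pair gets
   blocked, it can be deleted without violating Hall's condition. *)
Theorem fractional_hall r c b :
  (forall i, 0 <= c i) -> (forall v, 0 <= b v) -> hall_condition r c b ->
  exists z : I -> V -> R,
    [/\ forall i v, 0 <= z i v,
        forall i v, (i, v) \notin r -> z i v = 0,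
        forall i, c i <= \sum_v z i v
      & forall v, \sum_i z i v <= b v].
Proof.
have [n] := ubnP #|r|; elim: n r c b => [//|n IHn] r c b; rewrite ltnS => rn c0 b0 H.
have [r0|[[i v] riv]] := set_0Vmem r.
  exists (fun _ _ => 0); split=> // [i|v]; last by rewrite big1_eq.
  have := H [set i]%SET; rewrite big_set1 big1_eq big1 // => v /nbhdP[j _].
  by rewrite r0 inE.
pose g S := \sum_(v in nbhd r S) b v - \sum_(i in S) c i.
pose c' e := fun j => c j - (if j == i then e else 0).
pose b' e := fun w => b w - (if w == v then e else 0).
(* Induction on the number of pairs: solve the instance left after pushing [e] and deleting
   [(i, v)], then put [e] back on that pair. *)
suff [e [e0 ec eb He]] : exists e, [/\ 0 <= e, e <= c i, e <= b v &
    hall_condition (r :\ (i, v))%SET (c' e) (b' e)].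
  have rn' : (#|(r :\ (i, v))%SET| < n)%N.
    by move: rn; rewrite (cardsD1 (i, v)) riv.
  have [||z [z0 zr zc zb]] := IHn _ _ _ rn' _ _ He.
  - by move=> j; rewrite /c'; case: eqP => [->|_]; rewrite ?subr_ge0 ?subr0.
  - by move=> w; rewrite /b'; case: eqP => [->|_]; rewrite ?subr_ge0 ?subr0.
  exists (fun j w => z j w + (if (j == i) && (w == v) then e else 0)); split.
  - by move=> j w; rewrite addr_ge0 //; case: ifP.
  - move=> j w rjw; rewrite zr ?add0r; last by rewrite !inE negb_and rjw orbT.
    by case: andP => // -[/eqP ji /eqP wv]; rewrite ji wv riv in rjw.
  - move=> j; rewrite big_split /=; have := zc j; rewrite /c'.
    case: eqP => _ /=; first by rewrite -big_mkcond big_pred1_eq; lra.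
    by rewrite big1_eq; lra.
  - move=> w; rewrite big_split /=; have := zb w; rewrite /b'.
    case: eqP => _ /=.
      under [X in _ -> _ + X <= _]eq_bigr do rewrite andbT.
      by rewrite -big_mkcond big_pred1_eq; lra.
    by under [X in _ -> _ + X <= _]eq_bigr do rewrite andbF; rewrite big1_eq; lra.
pose m := Num.min (c i) (b v).
have mc : m <= c i by rewrite ge_min lexx.
have mb : m <= b v by rewrite ge_min lexx orbT.
have m0 : 0 <= m by rewrite le_min c0 b0.
have b'0 e : e <= b v -> forall w, 0 <= b' e w.
  by move=> eb w; rewrite /b'; case: eqP => [->|_]; rewrite ?subr_ge0 ?subr0.
(* These sets block a push of [m]. If there are any, push the least slack among them, which makes
   the minimiser tight. *)
pose P S := [&& i \notin S, v \in nbhd r S & g S < m].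
case: (pickP P) => [S0 PS0|noP].
  have [S /and3P[iS vS Sm] Smin] := arg_minP g PS0.
  exists (g S); split; first by rewrite subr_ge0.
  - exact: le_trans (ltW Sm) mc.
  - exact: le_trans (ltW Sm) mb.
  apply: (@hall_delete_tight _ _ _ _ _ S) => //.
  - by apply: b'0; apply: le_trans (ltW Sm) mb.
  - apply: hall_push => // T iT vT; case: (ltP (g T) m) => Tm.
      by apply: Smin; rewrite /P iT vT.
    exact: le_trans (ltW Sm) Tm.
  - by rewrite !sum_subD1 (negbTE iS) vS /g; lra.
have Hm : hall_condition r (c' m) (b' m).
  apply: hall_push => // T iT vT; have := noP T.
  by rewrite /P iT vT /= ltNge => /negbFE.
exists m; split=> //.
(* With no blocking set, pushing [m] exhausts the supply of [i] or the capacity of [v]. *)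
have [cb|bc] := leP (c i) (b v).
  apply: hall_delete_supply => //; first exact: b'0.
  by rewrite /c' eqxx /m min_l // subrr.
apply: hall_delete_capacity => //.
by rewrite /b' eqxx /m min_r ?subrr // ltW.
Qed.

End FractionalHall.

(** * Sums over edges and their endpoints *)

Section EdgeSums.
Variables (R : realType) (V : finType).
Implicit Types (E F : {set {set V}}) (e : {set V}) (x : V -> R).

Lemma sum_degree F x :
  \sum_(u in incident_vertices F) (degree F u)%:R * x u =
  \sum_(e in F) \sum_(u in e) x u.
Proof.
rewrite (exchange_big_dep (mem (incident_vertices F))) /=; last first.
  by move=> e u eF ue; rewrite inE; apply/exists_inP; exists e.
apply: eq_bigr => u _; rewrite sumr_const mulr_natl.
by congr (_ *+ _); apply: eq_card => e; rewrite !inE.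
Qed.

Lemma sum_other_endpoint e (g : V -> R) : #|e| = 2%N ->
  \sum_(v in e) \sum_(w in e | w != v) g w = \sum_(w in e) g w.
Proof.
move=> e2; rewrite (exchange_big_dep (mem e)) /=; last by move=> v w _ /andP[].
apply: eq_bigr => w we; rewrite sumr_const.
rewrite (_ : #|_| = 1%N) ?mulr1n //.
have := cardsD1 w e; rewrite e2 we => -[->].
by apply: eq_card => v; rewrite !inE [LHS]unfold_in /=; case: (v \in e); rewrite /= ?we ?andbF ?andbT // eq_sym.
Qed.

Lemma sum_other_other_endpoint e (g : V -> R) v : #|e| = 2%N -> v \in e ->
  \sum_(w in e | w != v) \sum_(u in e | u != w) g u = g v.
Proof.
move=> e2 ve; have [a eE av] : exists2 a, e = [set v; a]%SET & a != v.
  have /cards2P[p [q [pq eE]]] : #|e| == 2%N by rewrite e2.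
  move: ve; rewrite eE !inE => /orP[] /eqP ->; first by exists q; rewrite // eq_sym.
  by exists p; rewrite // finset.setUC.
rewrite eE.
rewrite (big_pred1 a) => [|w]; last first.
  by rewrite !inE; case: (eqVneq w v) => [->|_] /=; rewrite ?andbT // eq_sym (negbTE av).
rewrite (big_pred1 v) // => w.
by rewrite !inE; case: (eqVneq w a) => [->|_] /=; rewrite ?andbF ?(negbTE av) ?orbF ?andbT.
Qed.

(** Neighbours of [v] correspond to edges at [v]; the sum over edges can be exchanged with sums over
    vertices. *)
Lemma sum_star E v (g : {set V} -> V -> R) : simple_graph E ->
  \sum_(w | adjacent E v w) g [set v; w]%SET w =
  \sum_(e in E | v \in e) \sum_(w in e | w != v) g e w.
Proof.
move=> hG; rewrite (exchange_big_dep (adjacent E v)) /=; last first.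
  move=> e w /andP[eE ve] /andP[we wv]; rewrite /adjacent.
  suff -> : [set v; w]%SET = e by [].
  apply/eqP; rewrite eqEcard (hG e eE) cards2 eq_sym wv andbT.
  by apply/fintype.subsetP => u; rewrite !inE => /orP[] /eqP ->.
apply: eq_bigr => w vw; rewrite (big_pred1 [set v; w]%SET) // => e /=.
have wv : w != v.
  by apply/eqP => wv; have := hG _ vw; rewrite wv finset.setUid cards1.
rewrite wv andbT; apply/idP/eqP => [/andP[/andP[eE ve] we]|->]; last first.
  by rewrite !inE !eqxx orbT !andbT.
apply/esym/eqP; rewrite eqEcard (hG e eE) cards2 eq_sym wv andbT.
by apply/fintype.subsetP => u; rewrite !inE => /orP[] /eqP ->.
Qed.

End EdgeSums.

(** * The two inclusions between the polyhedra *)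

Section Polyhedra.
Variables (R : realType) (V : finType) (E : {set {set V}}).
Hypothesis hG : simple_graph E.
Implicit Types (F : {set {set V}}) (e f : {set V}) (x : V -> R).

(* The defining inequality of the polyhedron in the slacks [1 - x u], by
   double counting of the incidences of [F]. *)
Lemma P_Edge_SDP x : P_Edge_SD R E x <->
  (forall u, 0 <= x u <= 1) /\
  (forall F, F != finset.set0 -> F \subset E ->
     \sum_(e in F) (1 - \sum_(u in e) x u) + 1 <=
     \sum_(u in incident_vertices F) (1 - x u)).
Proof.
suff eqF F : (#|F|%:R - #|incident_vertices F|%:R + 1 <=
    \sum_(u in incident_vertices F) ((degree F u)%:R - 1) * x u) =
  (\sum_(e in F) (1 - \sum_(u in e) x u) + 1 <=
     \sum_(u in incident_vertices F) (1 - x u)).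
  rewrite /P_Edge_SD /=; split=> -[x01 H]; split=> // F F0 FE.
    by rewrite -eqF H.
  by rewrite eqF H.
under eq_bigr do rewrite mulrBl mul1r.
rewrite !sumrB sum_degree !sumr_const.
by apply/idP/idP; lra.
Qed.

(* [z e v] is the part of edge [e] oriented towards [v]; only the edges other
   than [f] are oriented, and only towards vertices outside [f]. *)
Definition orientation f x (z : {set V} -> V -> R) : Prop :=
    [/\ forall e v, 0 <= z e v,
        forall e v, ~~ [&& e \in E, e != f, v \in e & v \notin f] -> z e v = 0,
        forall e, e \in E -> e != f ->
          1 - \sum_(u in e) x u <= \sum_(v in e) z e v
      & forall v, v \notin f -> \sum_e z e v = 1 - x v].

(** Hall's theorem only bounds the inflow at [v] by [1 - x v]; the shortfall is then added on some
    edge at [v]. *)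
Lemma exact_orientation f x : no_isolated E -> P_Edge_SD R E x -> f \in E ->
  exists z, orientation f x z.
Proof.
move=> hiso /P_Edge_SDP[x01 xP] fE.
pose ok e v := [&& e \in E, e != f, v \in e & v \notin f].
(* Truncation at 0, because Hall's theorem needs nonnegative supplies. *)
pose c e : R := if (e \in E) && (e != f) then
  Num.max 0 (1 - \sum_(u in e) x u) else 0.
pose b v : R := 1 - x v.
have b0 v : 0 <= b v by rewrite subr_ge0; case/andP: (x01 v).
have c0 e : 0 <= c e by rewrite /c; case: ifP => // _; rewrite le_max lexx.
have H : hall_condition [set p | ok p.1 p.2]%SET c b.
  move=> S.
  (* Keeping only the edges of positive supply removes the truncation; the density inequality is
     then applied to [S'] with [f] added. *)
  pose S' := [set e in S | [&& e \in E, e != f & 0 < 1 - \sum_(u in e) x u]]%SET.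
  have fS' : f \notin S' by rewrite inE eqxx /= !andbF.
  have -> : \sum_(e in S) c e = \sum_(e in S') (1 - \sum_(u in e) x u).
    rewrite [LHS]big_mkcond [RHS]big_mkcond; apply: eq_bigr => e _.
    rewrite inE /c; case: (e \in S) => //=; rewrite andbA.
    by case: ifP => //= _; case: ltP => // h; apply/eqP.
  have F0 : (f |: S')%SET != finset.set0 by apply/set0Pn; exists f; rewrite setU11.
  have FE : (f |: S')%SET \subset E.
    apply/fintype.subsetP => e; rewrite !inE => /orP[/eqP -> //|].
    by case/and4P.
  have := xP _ F0 FE; rewrite big_setU1 //=.
  have -> : \sum_(u in incident_vertices (f |: S')%SET) (1 - x u) =
      \sum_(u in f) (1 - x u) + 
      \sum_(u in (incident_vertices (f |: S') :\: f)%SET) (1 - x u).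
    rewrite (big_setID f) /=; congr (_ + _); apply: eq_bigl => u.
    rewrite inE andbC; case uf : (u \in f) => //=; rewrite inE.
    by apply/exists_inP; exists f; rewrite // setU11.
  (* As [f] has two endpoints, its term plus the constant 1 cancels the slacks at these
     endpoints. *)
  rewrite [in X in _ <= X -> _]sumrB sumr_const (hG fE).
  have sub : (incident_vertices (f |: S') :\: f)%SET \subset
      nbhd [set p | ok p.1 p.2]%SET S.
    apply/fintype.subsetP => u; rewrite !inE => /andP[uf /exists_inP[e]].
    rewrite in_setU1 => /orP[/eqP -> /(negP uf) //|].
    rewrite inE => /and4P[eS eE ef _] ue.
    by apply/exists_inP; exists e; rewrite // inE /ok eE ef ue uf.
  have := ler_sum_subset b0 sub; rewrite /b; lra.
have [z [z0 zr zc zb]] := fractional_hall c0 b0 H.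
have [|h hP] := @choice _ _ (fun v e => (e \in E) && (v \in e)).
  by move=> v; have [w vw] := hiso v; exists [set v; w]%SET; rewrite !inE eqxx andbT.
pose s v := b v - \sum_e z e v.
have s0 v : 0 <= s v by rewrite subr_ge0.
exists (fun e v => z e v + (if (e == h v) && (v \notin f) then s v else 0)).
split.
- by move=> e v; rewrite addr_ge0 //; case: ifP.
- move=> e v evN; rewrite zr ?inE // add0r; case: andP => // -[/eqP eh vf].
  (* The chosen edge at a vertex outside [f] cannot be [f]. *)
  have /andP[hE vh] := hP v; move: evN; rewrite eh hE vh vf /= andbT negbK.
  by move=> /eqP hf; rewrite -hf vh in vf.
- move=> e eE ef; apply: (@le_trans _ _ (\sum_(v in e) z e v)); last first.
    by apply: ler_sum => v _; rewrite lerDl; case: ifP.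
  have <- : \sum_v z e v = \sum_(v in e) z e v.
    rewrite [RHS]big_mkcond; apply: eq_bigr => v _; case: ifPn => // ve.
    by rewrite zr // inE /ok /= (negbTE ve) !andbF.
  apply: le_trans (zc e); rewrite /c eE ef /=.
  by rewrite le_max lexx orbT.
- move=> v vf; rewrite big_split /= vf.
  under [X in _ + X = _]eq_bigr do rewrite andbT.
  by rewrite -big_mkcond big_pred1_eq /s addrC subrK.
Qed.

Lemma P_Edge_SD_sub_Q_orient x :
  no_isolated E -> P_Edge_SD R E x -> Q_orient R E x.
Proof.
move=> hiso Px.
have [|z zP] := @choice _ _ (fun f z => f \in E -> orientation f x z).
  move=> f; have [fE|fE] := boolP (f \in E); last by exists (fun _ _ => 0).
  by have [z zP] := exact_orientation hiso Px fE; exists z.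
have [x01 _] := Px.
(* At the endpoint [u] of [e], the paper's [y] is the share of the other endpoint. *)
pose y f e u := if e == f then 1 else \sum_(v in e | v != u) z f e v.
have y0 f e v : f \in E -> 0 <= y f e v.
  move=> fE; have [z0 _ _ _] := zP f fE; rewrite /y.
  by case: ifP => // _; rewrite sumr_ge0.
exists (x, y) => //; split=> //=.
- move=> f e v w fE eE eE'; have [z0 zr zc zv] := zP f fE.
  have e2 := hG eE; have vw : v != w.
    by move: e2; rewrite eE' cards2; case: eqP.
  have sum2 (g : V -> R) : \sum_(u in e) g u = g v + g w.
    by rewrite eE' big_setU1 ?inE //= big_set1.
  have [->|ef] := eqVneq e f.
    rewrite /y eqxx; have /andP[? _] := x01 v; have /andP[? _] := x01 w; lra.
  have := zc e eE ef; rewrite -(sum_other_endpoint (z f e) e2) !sum2 /y (negbTE ef); lra.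
- move=> f v fE; have [z0 zr zc zv] := zP f fE.
  rewrite (sum_star v (y f)) //.
  have [vf|vf] := boolP (v \in f).
    (* For an endpoint of [f], the cost-free value 1 on [f] already meets the constraint. *)
    rewrite (bigD1 f) ?fE //=; have : 1 <= \sum_(w in f | w != v) y f f w.
      rewrite /y eqxx sumr_const; have := cardsD1 v f; rewrite (hG fE) vf add1n.
      rewrite (_ : #|(f :\ v)%SET| = #|[pred w in f | w != v]|); last first.
        by apply: eq_card => w; rewrite !inE andbC.
      by move=> [<-].
    have : 0 <= \sum_(e | (e \in E) && (v \in e) && (e != f))
        \sum_(w in e | w != v) y f e w.
      by apply: sumr_ge0 => e _; apply: sumr_ge0 => w _; apply: y0.
    have /andP[? _] := x01 v; lra.
  (* Swapping endpoints twice gives back [z], so the star sum is the inflow at [v]. *)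
  have -> : \sum_(e in E | v \in e) \sum_(w in e | w != v) y f e w = \sum_e z f e v.
    rewrite [LHS]big_mkcond; apply: eq_bigr => e _; case: ifP => [/andP[eE ve]|evN].
      have ef : e != f by apply: contraNneq vf => <-.
      by rewrite /y (negbTE ef) sum_other_other_endpoint // hG.
    by rewrite zr //; apply: contraFN evN => /and4P[-> _ ->].
  by rewrite zv // addrC subrK.
- move=> f fE; have [z0 zr zc zv] := zP f fE.
  (* Since inflows are exact, the left side of the budget constraint is the number of vertices
     outside [f]. *)
  have -> : \sum_(e in E | e != f) \sum_(v in e) y f e v =
            \sum_(v | v \notin f) (1 - x v).
    transitivity (\sum_e \sum_v z f e v).
      rewrite big_mkcond; apply: eq_bigr => e _; case: ifPn => [/andP[eE ef]|eN].
        rewrite /y (negbTE ef) sum_other_endpoint ?hG //.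
        rewrite big_mkcond; apply: eq_bigr => v _; case: ifPn => // ve.
        by rewrite zr // (negbTE ve) !andbF.
      by rewrite big1 // => v _; rewrite zr // andbA (negbTE eN).
    rewrite exchange_big /= [RHS]big_mkcond; apply: eq_bigr => v _.
    case: ifPn => [/zv //|vf]; rewrite big1 // => e _.
    by rewrite zr // (negbTE vf) !andbF.
  rewrite -big_split /=; under eq_bigr do rewrite subrKC.
  rewrite sumr_const lerBrDr -natrD ler_nat -(cardC f) (hG fE) addnC.
  by rewrite leq_add2l.
- by move=> f e v fE _ _; apply: y0.
Qed.

(** For any [f] in [F], the budget constraint of [f] has to cover the edges of [F] other than [f],
    by the edge constraints, and the vertices missed by [F], by the vertex constraints. *)
Lemma Q_orient_sub_P_Edge_SD x : Q_orient R E x -> P_Edge_SD R E x.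
Proof.
case=> -[x' y] /= [yedge yvert ysum y0 x01] <-; apply/P_Edge_SDP; split=> // F.
case/set0Pn=> f fF FE; have fE : f \in E := fintype.subsetP FE f fF.
have y0e e (P : pred V) : e \in E -> 0 <= \sum_(v in e | P v) y f e v.
  by move=> eE; apply: sumr_ge0 => v /andP[ve _]; apply: y0.
have edge e : e \in E -> 1 - \sum_(u in e) x' u <= \sum_(u in e) y f e u.
  move=> eE; have /cards2P[v [w [vw ee]]] : #|e| == 2%N by rewrite hG.
  have /= := yedge f e v w fE eE ee.
  have sum2 (g : V -> R) : \sum_(u in e) g u = g v + g w.
    by rewrite ee big_setU1 ?inE //= big_set1.
  by rewrite !sum2; lra.
(* Edges at a vertex missed by [F] lie outside [F], and each of their [y] values is used at most
   once. *)
have outside : \sum_(v | v \notin incident_vertices F) (1 - x' v) <=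
    \sum_(e in E :\: F) \sum_(w in e) y f e w.
  apply: (@le_trans _ _ (\sum_(v | v \notin incident_vertices F)
      \sum_(e in E | v \in e) \sum_(w in e | w != v) y f e w)).
    apply: ler_sum => v _; rewrite -sum_star //.
    by have /= := yvert f v fE; lra.
  rewrite (exchange_big_dep (mem (E :\: F)%SET)) /=; last first.
    move=> v e vF /andP[eE ve]; rewrite inE eE andbT.
    by apply: contra vF => eF; rewrite inE; apply/exists_inP; exists e.
  apply: ler_sum => e; rewrite inE => /andP[_ eE].
  rewrite -[leRHS](sum_other_endpoint _ (hG eE)).
  rewrite [leLHS]big_mkcond [leRHS]big_mkcond; apply: ler_sum => v _.
  rewrite eE /=; case: (v \in e); rewrite ?andbF //= andbT.
  by case: ifP => // _; apply: y0e.
have inside : \sum_(e in F :\ f) (1 - \sum_(u in e) x' u) <=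
    \sum_(e in F :\ f) \sum_(u in e) y f e u.
  by apply: ler_sum => e /setD1P[_ /(fintype.subsetP FE)]; apply: edge.
have total : \sum_(e in E | e != f) \sum_(v in e) y f e v =
    \sum_(e in F :\ f) \sum_(u in e) y f e u +
    \sum_(e in E :\: F) \sum_(w in e) y f e w.
  rewrite (bigID (mem F)) /=; congr (_ + _); apply: eq_bigl => e; rewrite !inE.
    case: (boolP (e \in F)) => eF; rewrite ?andbF // !andbT.
    by rewrite (fintype.subsetP FE).
  case: (boolP (e \in F)) => eF; rewrite ?andbF // !andbT /=.
  by rewrite (contraNneq _ eF) ?andbT // => ->.
have sumV (A : {set V}) : \sum_v (1 - x' v) =
    \sum_(v in A) (1 - x' v) + \sum_(v | v \notin A) (1 - x' v).
  by rewrite (bigID (mem A)).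
have /= := ysum f fE; rewrite total (big_setD1 f fF) /=.
have : #|V|%:R = 2 + \sum_(v | v \notin f) 1 :> R.
  by rewrite sumr_const -natrD -(cardC f) (hG fE).
have sumf : \sum_(v in f) (1 - x' v) = 2 - \sum_(v in f) x' v.
  by rewrite sumrB sumr_const (hG fE).
(* Splitting the total slack both by [f] and by the vertices of [F] trades the slack outside [f] for
   the slack on [F]. *)
have := sumV f; rewrite (sumV (incident_vertices F)) sumf.
rewrite [\sum_(v | v \notin f) (1 - x' v)]sumrB.
by lra.
Qed.

End Polyhedra.

Theorem theorem5 (R : realType) (V : finType) (E : {set {set V}})
  (hG : simple_graph E) (hcycle : has_cycle E) (hiso : no_isolated E) :
  P_Edge_SD R E = Q_orient R E.
Proof.
apply/seteqP; split=> x; first exact: P_Edge_SD_sub_Q_orient.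
exact: Q_orient_sub_P_Edge_SD.
Qed.
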